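(* Let $\Bbbk$ be a field of characteristic zero, let $\mathfrak g$ be a free (right) Leibniz algebra over $\Bbbk$, let $(B,\cdot)$ be a dual Leibniz algebra over $\Bbbk$, and let $M$ be a $B$-bimodule. Then the cochain map $$\Psi : C^{*}_{\mathcal{DL}}(B,M)\longrightarrow C^{*}_{\mathrm{Lie}}(\mathfrak g\otimes B,\ \mathfrak g\otimes M),$$ $$\Psi(f)(x_1\otimes b_1,\dots,x_n\otimes b_n)=\sum_{\sigma\in S_n}\operatorname{sgn}(\sigma)\,[x_{\sigma(1)},x_{\sigma(2)},\dots,x_{\sigma(n)}]\otimes f(b_{\sigma(1)},\dots,b_{\sigma(n)})$$ (for $f\in C^n_{\mathcal{DL}}(B,M)$, $n\ge1$, $x_i\in\mathfrak g$, $b_i\in B$) is injective.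
   Context: All vector spaces and tensor products are over a field $\Bbbk$ of characteristic zero. A (right) Leibniz algebra is a vector space $\mathfrak g$ with a bilinear bracket satisfying $[x,[y,z]]=[[x,y],z]-[[x,z],y]$ for all $x,y,z$. Left-normed brackets are defined by $[x_1]=x_1$ and $[x_1,\dots,x_n]=[[x_1,\dots,x_{n-1}],x_n]$. A dual Leibniz (Zinbiel) algebra is a vector space $B$ with a bilinear product satisfying $(x\cdot y)\cdot z=x\cdot(y\cdot z+z\cdot y)$ for all $x,y,z\in B$. A $B$-bimodule (representation) is a vector space $M$ with bilinear maps $B\times M\to M$ and $M\times B\to M$, both written $\cdot$, such that the identity $(x\cdot y)\cdot z=x\cdot(y\cdot z+z\cdot y)$ holds whenever one of $x,y,z$ lies in $M$ and the other two lie in $B$. Lie structures. The space $\mathfrak g\otimes B$ is a Lie algebra with bracket $$(a_1\otimes b_1)\ast(a_2\otimes b_2)=[a_1,a_2]\otimes(b_1\cdot b_2)-[a_2,a_1]\otimes(b_2\cdot b_1),$$ and $\mathfrak g\otimes M$ is a Lie module over it with action $$(a_1\otimes b)\ast(a_2\otimes m)=[a_1,a_2]\otimes(b\cdot m)-[a_2,a_1]\otimes(m\cdot b).$$ $C^n_{\mathcal{DL}}(B,M)$ ($n\ge1$) is the space of $n$-linear maps $B^{\otimes n}\to M$. $C^n_{\mathrm{Lie}}(L,N)$, for a Lie algebra $L$ and an $L$-module $N$, is the space of alternating $n$-linear maps $L^n\to N$. Injectivity of $\Psi$ means injectivity of $\Psi:C^n_{\mathcal{DL}}(B,M)\to C^n_{\mathrm{Lie}}(\mathfrak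 g\otimes B,\mathfrak g\otimes M)$ for every $n\ge1$; this does not involve the differentials.
   Formalization: The free Leibniz algebra is assumed to have at least two free generators; for zero or one generator the claim fails (e.g. one generator, n = 3, B = M = k with zero products, f(a,b,c) = abc gives Ψ(f) = 0). *)

(* Defs.v *)
From HB Require Import structures.
From mathcomp Require Import all_boot all_order all_algebra all_fingroup.
From mathcomp Require Import sesquilinear generic_quotient boolp.

Set Implicit Arguments.
Unset Strict Implicit.
Unset Printing Implicit Defensive.

Import GRing.Theory.
Local Open Scope ring_scope.
Local Open Scope quotient_scope.

Definition bilinear (K : fieldType) (U V W : lmodType K) (f : U -> V -> W) :=
  bilinear_for *:%R *:%R f.

HB.mixin Record isLeibniz (K : fieldType) V of GRing.Lmodule K V := {
  leibniz_bracket : V -> V -> V;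
  leibniz_bilinear : bilinear leibniz_bracket;
  leibniz_identity : forall x y z,
    leibniz_bracket x (leibniz_bracket y z) =
      leibniz_bracket (leibniz_bracket x y) z -
      leibniz_bracket (leibniz_bracket x z) y }.

#[short(type="leibnizType")]
HB.structure Definition Leibniz (K : fieldType) :=
  { V of GRing.Lmodule K V & isLeibniz K V }.

HB.mixin Record isZinbiel (K : fieldType) V of GRing.Lmodule K V := {
  zmul : V -> V -> V;
  zmul_bilinear : bilinear zmul;
  zinbiel_identity : forall x y z,
    zmul (zmul x y) z = zmul x (zmul y z + zmul z y) }.

#[short(type="zinbielType")]
HB.structure Definition Zinbiel (K : fieldType) :=
  { V of GRing.Lmodule K V & isZinbiel K V }.

HB.mixin Record isZinbielBimod (K : fieldType) (B : zinbielType K) M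
    of GRing.Lmodule K M := {
  lact : B -> M -> M;
  ract : M -> B -> M;
  lact_bilinear : bilinear lact;
  ract_bilinear : bilinear ract;
  zinbiel_mBB : forall (m : M) (y z : B),
    ract (ract m y) z = ract m (zmul y z + zmul z y);
  zinbiel_BmB : forall (x : B) (m : M) (z : B),
    ract (lact x m) z = lact x (ract m z + lact z m);
  zinbiel_BBm : forall (x y : B) (m : M),
    lact (zmul x y) m = lact x (lact y m + ract m y) }.

#[short(type="zinbielBimodType")]
HB.structure Definition ZinbielBimod (K : fieldType) (B : zinbielType K) :=
  { M of GRing.Lmodule K M & isZinbielBimod K B M }.

HB.mixin Record isLie (K : fieldType) L of GRing.Lmodule K L := {
  lie_bracket : L -> L -> L;
  lie_bilinear : bilinear lie_bracket;
  lie_alternating : forall x, lie_bracket x x = 0;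
  lie_jacobi : forall x y z,
    lie_bracket x (lie_bracket y z) + lie_bracket y (lie_bracket z x) +
    lie_bracket z (lie_bracket x y) = 0 }.

#[short(type="lieType")]
HB.structure Definition Lie (K : fieldType) :=
  { L of GRing.Lmodule K L & isLie K L }.

HB.mixin Record isLieMod (K : fieldType) (L : lieType K) N
    of GRing.Lmodule K N := {
  lie_act : L -> N -> N;
  lie_act_bilinear : bilinear lie_act;
  lie_actA : forall (x y : L) (m : N),
    lie_act (lie_bracket x y) m =
      lie_act x (lie_act y m) - lie_act y (lie_act x m) }.

#[short(type="lieModType")]
HB.structure Definition LieMod (K : fieldType) (L : lieType K) :=
  { N of GRing.Lmodule K N & isLieMod K L N }.

Definition leibniz_morphism (K : fieldType) (g h : leibnizType K)
    (u : g -> h) : Prop :=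
  linear u /\ {morph u : x y / leibniz_bracket x y >-> leibniz_bracket x y}.

Definition free_leibniz (K : fieldType) (g : leibnizType K) (X : Type)
    (iota : X -> g) : Prop :=
  forall (h : leibnizType K) (phi : X -> h),
    exists! u : g -> h, leibniz_morphism u /\ forall x, u (iota x) = phi x.

(* [x_1, ..., x_n] = [[x_1, ..., x_(n-1)], x_n]; the value 0 on the empty
   sequence is a dummy. *)
Definition left_normed (K : fieldType) (g : leibnizType K) (s : seq g) : g :=
  if s is x :: s' then foldl (@leibniz_bracket K g) x s' else 0.

(* A formal sum of pure tensors is a sequence of pairs; scalars can be absorbed
   in either component. Two of them are identified when no bilinear map
   separates them. The universal property is given by bilinear_pure, tliftE,
   tlift_linear and linear_tensor_ext below. *)
Definition tensor_eq (K : fieldType) (V W : lmodType K) : rel (seq (V * W)) :=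
  fun s t => `[< forall (U : lmodType K) (f : V -> W -> U), bilinear f ->
    \sum_(p <- s) f p.1 p.2 = \sum_(p <- t) f p.1 p.2 >].

Section Tensor.
Variables (K : fieldType) (V W : lmodType K).

Lemma tensor_eq_refl : reflexive (@tensor_eq K V W).
Proof. by move=> s; apply/asboolP. Qed.

Lemma tensor_eq_sym : symmetric (@tensor_eq K V W).
Proof.
by move=> s t; apply/asboolP/asboolP => e U f bf; rewrite (e U f bf).
Qed.

Lemma tensor_eq_trans : transitive (@tensor_eq K V W).
Proof.
move=> t s r /asboolP e1 /asboolP e2; apply/asboolP => U f bf.
by rewrite (e1 U f bf) (e2 U f bf).
Qed.

Canonical tensor_equiv :=
  EquivRel (@tensor_eq K V W) tensor_eq_refl tensor_eq_sym tensor_eq_trans.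

Definition tensor := {eq_quot tensor_equiv}.
HB.instance Definition _ := Choice.on tensor.
HB.instance Definition _ := EqQuotient.on tensor.

Definition pure (v : V) (w : W) : tensor := \pi_tensor [:: (v, w)].

Definition tlift (U : lmodType K) (f : V -> W -> U) (x : tensor) : U :=
  \sum_(p <- repr x) f p.1 p.2.

Lemma tlift_pi (U : lmodType K) (f : V -> W -> U) s : bilinear f ->
  tlift f (\pi_tensor s) = \sum_(p <- s) f p.1 p.2.
Proof.
move=> bf; rewrite /tlift.
have /eqP : \pi_tensor (repr (\pi_tensor s)) = \pi_tensor s by rewrite reprK.
by rewrite piE /= => /asboolP /(_ U f bf).
Qed.

Lemma tensorP (x y : tensor) :
  (forall (U : lmodType K) (f : V -> W -> U), bilinear f ->
    tlift f x = tlift f y) -> x = y.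
Proof.
move=> e; rewrite -[x]reprK -[y]reprK; apply/eqP; rewrite piE /=.
by apply/asboolP => U f bf; have := e U f bf; rewrite /tlift.
Qed.

Definition tadd (x y : tensor) : tensor := \pi_tensor (repr x ++ repr y).
Definition tscale (a : K) (x : tensor) : tensor :=
  \pi_tensor [seq (a *: p.1, p.2) | p <- repr x].
Definition tzero : tensor := \pi_tensor [::].
Definition topp (x : tensor) : tensor := tscale (-1) x.

Section TliftOps.
Variables (U : lmodType K) (f : V -> W -> U).
Hypothesis bf : bilinear f.

Lemma tliftD x y : tlift f (tadd x y) = tlift f x + tlift f y.
Proof. by rewrite tlift_pi // big_cat. Qed.

Lemma tliftZ a x : tlift f (tscale a x) = a *: tlift f x.
Proof.
rewrite tlift_pi // big_map /= scaler_sumr; apply: eq_bigr => p _.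
have := bf.1 p.2 a p.1 0; rewrite /= !addr0 => ->.
have := bf.1 p.2 (-1) 0 0.
by rewrite /= scaler0 addr0 scaleN1r addNr => ->; rewrite addr0.
Qed.

Lemma tlift0 : tlift f tzero = 0.
Proof. by rewrite tlift_pi // big_nil. Qed.

Lemma tliftN x : tlift f (topp x) = - tlift f x.
Proof. by rewrite /topp tliftZ scaleN1r. Qed.
End TliftOps.

Lemma taddA : associative tadd.
Proof. by move=> x y z; apply: tensorP => U f bf; rewrite !tliftD // addrA. Qed.
Lemma taddC : commutative tadd.
Proof. by move=> x y; apply: tensorP => U f bf; rewrite !tliftD // addrC. Qed.
Lemma tadd0 : left_id tzero tadd.
Proof.
by move=> x; apply: tensorP => U f bf; rewrite tliftD // tlift0 // add0r.
Qed.
Lemma taddN : left_inverse tzero topp tadd.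
Proof.
move=> x; apply: tensorP => U f bf.
by rewrite tliftD // tliftN // tlift0 // addNr.
Qed.

HB.instance Definition _ := GRing.isZmodule.Build tensor taddA taddC tadd0 taddN.

Lemma tscaleA a b x : tscale a (tscale b x) = tscale (a * b) x.
Proof. by apply: tensorP => U f bf; rewrite !tliftZ // scalerA. Qed.
Lemma tscale1 : left_id 1 tscale.
Proof. by move=> x; apply: tensorP => U f bf; rewrite tliftZ // scale1r. Qed.
Lemma tscaleDr : right_distributive tscale +%R.
Proof.
move=> a x y; apply: tensorP => U f bf.
by rewrite tliftZ // !tliftD // !tliftZ // scalerDr.
Qed.
Lemma tscaleDl x : {morph tscale^~ x : a b / a + b}.
Proof.
move=> a b; apply: tensorP => U f bf.
by rewrite tliftZ // !tliftD // !tliftZ // scalerDl.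
Qed.

HB.instance Definition _ := GRing.Zmodule_isLmodule.Build K tensor
  tscaleA tscale1 tscaleDr tscaleDl.

Lemma tlift_linear (U : lmodType K) (f : V -> W -> U) :
  bilinear f -> linear (tlift f).
Proof. by move=> bf a x y; rewrite tliftD // tliftZ. Qed.

Lemma tliftE (U : lmodType K) (f : V -> W -> U) v w :
  bilinear f -> tlift f (pure v w) = f v w.
Proof. by move=> bf; rewrite tlift_pi // big_seq1. Qed.

Lemma bilinear_pure : bilinear pure.
Proof.
split=> [w|v] a x y; apply: tensorP => U f bf;
  rewrite tliftD // tliftZ // !tliftE //; first exact: bf.1.
exact: bf.2.
Qed.

Lemma tensor_sum_pure (x : tensor) : x = \sum_(p <- repr x) pure p.1 p.2.
Proof.
rewrite -{1}[x]reprK; elim: (repr x) => [|p s IHs]; first by rewrite big_nil.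
rewrite big_cons -IHs; apply: tensorP => U f bf.
by rewrite tliftD // tliftE // !tlift_pi // big_cons.
Qed.

Lemma linear_tensor_ext (U : lmodType K) (f h : tensor -> U) :
  linear f -> linear h -> (forall v w, f (pure v w) = h (pure v w)) -> f =1 h.
Proof.
move=> lf lh e x; rewrite (tensor_sum_pure x).
elim: (repr x) => [|p s IHs].
  rewrite !big_nil.
  have f0 : f 0 = 0 by have := lf (-1) 0 0; rewrite scaler0 addr0 scaleN1r addNr.
  by have := lh (-1) 0 0; rewrite scaler0 addr0 scaleN1r addNr f0 => ->.
by rewrite !big_cons -[pure _ _]scale1r lf lh e IHs.
Qed.

End Tensor.

Notation "v \ox w" := (pure v w) (at level 40, left associativity, format "v  \ox  w").

Section BilinearTheory.
Variables (K : fieldType) (U V W : lmodType K) (f : U -> V -> W).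
Hypothesis bf : bilinear f.

Lemma bilDl x y v : f (x + y) v = f x v + f y v.
Proof. by have := bf.1 v 1 x y; rewrite /= !scale1r. Qed.
Lemma bilDr u x y : f u (x + y) = f u x + f u y.
Proof. by have := bf.2 u 1 x y; rewrite /= !scale1r. Qed.
Lemma bil0l v : f 0 v = 0.
Proof. by apply: (addIr (f 0 v)); rewrite -bilDl !add0r. Qed.
Lemma bil0r u : f u 0 = 0.
Proof. by apply: (addIr (f u 0)); rewrite -bilDr !add0r. Qed.
Lemma bilZl a x v : f (a *: x) v = a *: f x v.
Proof. by have := bf.1 v a x 0; rewrite /= !addr0 bil0l addr0. Qed.
Lemma bilZr a u x : f u (a *: x) = a *: f u x.
Proof. by have := bf.2 u a x 0; rewrite /= !addr0 bil0r addr0. Qed.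
Lemma bilNl x v : f (- x) v = - f x v.
Proof. by rewrite -scaleN1r bilZl scaleN1r. Qed.
Lemma bilNr u x : f u (- x) = - f u x.
Proof. by rewrite -scaleN1r bilZr scaleN1r. Qed.
Lemma bilBl x y v : f (x - y) v = f x v - f y v.
Proof. by rewrite bilDl bilNl. Qed.
Lemma bilBr u x y : f u (x - y) = f u x - f u y.
Proof. by rewrite bilDr bilNr. Qed.
End BilinearTheory.

Lemma bilinear_def (K : fieldType) (U V W : lmodType K) (f : U -> V -> W) :
  (forall v a x y, f (a *: x + y) v = a *: f x v + f y v) ->
  (forall u a x y, f u (a *: x + y) = a *: f u x + f u y) -> bilinear f.
Proof. by split. Qed.

Lemma tensor_ind (K : fieldType) (V W : lmodType K)
    (P : tensor V W -> Prop) :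
  P 0 -> (forall x y, P x -> P y -> P (x + y)) -> (forall v w, P (v \ox w)) ->
  forall x, P x.
Proof.
move=> P0 PD Pp x; rewrite (tensor_sum_pure x).
by elim: (repr x) => [|p s IHs]; rewrite ?big_nil // big_cons; apply: PD.
Qed.

(* The bracket of g (x) B and the action of g (x) B on g (x) M are both given by
   (a1 (x) b) * (a2 (x) m) = [a1, a2] (x) l b m - [a2, a1] (x) r m b for
   bilinear l and r, extended bilinearly. *)
Section TensorAct.
Variables (K : fieldType) (g : leibnizType K) (B M : lmodType K).
Variables (l : B -> M -> M) (r : M -> B -> M).

Definition pure_act (a1 : g) (b : B) (a2 : g) (m : M) : tensor g M :=
  leibniz_bracket a1 a2 \ox l b m - leibniz_bracket a2 a1 \ox r m b.

Definition tensor_act (x : tensor g B) (y : tensor g M) : tensor g M :=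
  tlift (fun a1 b => tlift (pure_act a1 b) y) x.

Hypotheses (bl : bilinear l) (br : bilinear r).
Let bb := @leibniz_bilinear K g.
Let bp := @bilinear_pure K g M.

Lemma subZD (X : lmodType K) (a : K) (x y x' y' : X) :
  a *: x + y - (a *: x' + y') = a *: (x - x') + (y - y').
Proof. by rewrite scalerBr opprD addrACA. Qed.

Lemma pure_act_bil2 a1 b : bilinear (pure_act a1 b).
Proof.
apply: bilinear_def => u a x y; rewrite /pure_act -subZD.
  by rewrite (bilDl bb) (bilDr bb) (bilZl bb) (bilZr bb)
     !(bilDl bp) !(bilZl bp).
by rewrite (bilDl br) (bilDr bl) (bilZl br) (bilZr bl)
     !(bilDr bp) !(bilZr bp).
Qed.

Lemma pure_act_bil1 a2 m : bilinear (fun a1 b => pure_act a1 b a2 m).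
Proof.
apply: bilinear_def => u a x y; rewrite /pure_act -subZD.
  by rewrite (bilDl bb) (bilDr bb) (bilZl bb) (bilZr bb)
     !(bilDl bp) !(bilZl bp).
by rewrite (bilDr br) (bilDl bl) (bilZr br) (bilZl bl)
     !(bilDr bp) !(bilZr bp).
Qed.

Lemma tlift_act_bil y : bilinear (fun a1 b => tlift (pure_act a1 b) y).
Proof.
apply: bilinear_def => u a x x'; elim/tensor_ind: y => [|y y' IHy IHy'|a2 m].
- by rewrite !tlift0 ?scaler0 ?addr0 //; apply: pure_act_bil2.
- rewrite !(tliftD (pure_act_bil2 _ _)) IHy IHy' scalerDr.
  by rewrite addrACA.
- rewrite !(tliftE _ _ (pure_act_bil2 _ _)); exact: (pure_act_bil1 a2 m).1.
- by rewrite !tlift0 ?scaler0 ?addr0 //; apply: pure_act_bil2.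
- rewrite !(tliftD (pure_act_bil2 _ _)) IHy IHy' scalerDr.
  by rewrite addrACA.
- rewrite !(tliftE _ _ (pure_act_bil2 _ _)); exact: (pure_act_bil1 a2 m).2.
Qed.

Lemma tensor_act_bilinear : bilinear tensor_act.
Proof.
apply: bilinear_def => u a x y; first exact: (tlift_linear (tlift_act_bil u)).
rewrite /tensor_act; elim/tensor_ind: u => [|u v IHu IHv|a1 b].
- by rewrite !tlift0 ?scaler0 ?addr0 //; apply: tlift_act_bil.
- rewrite !(tliftD (tlift_act_bil _)) IHu IHv scalerDr.
  by rewrite addrACA.
- rewrite !(tliftE _ _ (tlift_act_bil _)).
  exact: (tlift_linear (pure_act_bil2 _ _)).
Qed.

Lemma tensor_act_pure a1 b a2 m :
  tensor_act (a1 \ox b) (a2 \ox m) =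
  leibniz_bracket a1 a2 \ox l b m - leibniz_bracket a2 a1 \ox r m b.
Proof.
by rewrite /tensor_act (tliftE _ _ (tlift_act_bil _)) (tliftE _ _ (pure_act_bil2 _ _)).
Qed.
End TensorAct.

Section TensorActLie.
Variables (K : fieldType) (g : leibnizType K) (B : zinbielType K).
Variables (M : lmodType K) (l : B -> M -> M) (r : M -> B -> M).
Hypotheses (bl : bilinear l) (br : bilinear r).
Hypothesis mBB : forall m y z, r (r m y) z = r m (zmul y z + zmul z y).
Hypothesis BmB : forall x m z, r (l x m) z = l x (r m z + l z m).
Hypothesis BBm : forall x y m, l (zmul x y) m = l x (l y m + r m y).

Local Notation "[ x , y ]" := (leibniz_bracket x y).
Local Notation tbr := (tensor_act (g := g) (@zmul K B) (@zmul K B)).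
Local Notation tac := (tensor_act (g := g) l r).
Let bz := @zmul_bilinear K B.
Let bpM := @bilinear_pure K g M.
Let btbr : bilinear tbr := tensor_act_bilinear g bz bz.
Let btac : bilinear tac := tensor_act_bilinear g bl br.

Lemma tensor_act_pure2 a1 b1 a2 b2 a3 m :
  tac (a1 \ox b1) (tac (a2 \ox b2) (a3 \ox m)) =
  [[a1, a2], a3] \ox l b1 (l b2 m + r m b2)
  - [[a1, a3], a2] \ox l b1 (l b2 m + r m b2)
  - [[a2, a3], a1] \ox l b2 (l b1 m + r m b1)
  + [[a3, a2], a1] \ox r m (zmul b1 b2 + zmul b2 b1).
Proof.
rewrite [X in tac _ X](tensor_act_pure bl br) (bilBr btac).
rewrite !(tensor_act_pure bl br) mBB BmB !leibniz_identity.
rewrite [zmul b2 b1 + _]addrC [r m b1 + _]addrC.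
rewrite -[[[a1, a3], a2] - _]opprB (bilNl bpM) opprB opprK.
set X := _ \ox r _ _; set Y := _ \ox l b2 _.
rewrite (bilDr bl) !(bilDr bpM) !(bilBl bpM) -!addrA.
congr (_ + _); rewrite [X + _]addrC !addrA; congr (_ + X).
rewrite opprD -!addrA [RHS]addrCA; congr (_ + _).
by rewrite addrC -addrA.
Qed.

Lemma tensor_bracket_act_pure a1 b1 a2 b2 a3 m :
  tac (tbr (a1 \ox b1) (a2 \ox b2)) (a3 \ox m) =
  [[a1, a2], a3] \ox l b1 (l b2 m + r m b2)
  - [[a2, a1], a3] \ox l b2 (l b1 m + r m b1)
  - [[a3, a1], a2] \ox r m (zmul b1 b2 + zmul b2 b1)
  + [[a3, a2], a1] \ox r m (zmul b1 b2 + zmul b2 b1).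
Proof.
rewrite (tensor_act_pure bz bz) (bilBl btac) !(tensor_act_pure bl br) !BBm.
rewrite !leibniz_identity !opprB (bilDr br) !(bilBl bpM).
set X := _ \ox l b1 _; set Y := _ \ox l b2 _.
rewrite !(bilDr bpM) !opprD !opprK -!addrA; congr (X + _).
rewrite !addrA; set p := _ \ox r m _; set q := _ \ox r m _.
set s := _ \ox r m _; set t := _ \ox r m _.
by rewrite [LHS](ACl (5*1*4*2*3)).
Qed.

Lemma tensor_actA x y m :
  tac (tbr x y) m = tac x (tac y m) - tac y (tac x m).
Proof.
elim/tensor_ind: x => [|x x' IHx IHx'|a1 b1].
- by rewrite (bil0l btbr) !(bil0l btac) (bil0r btac) subr0.
- by rewrite (bilDl btbr) !(bilDl btac) (bilDr btac) IHx IHx' opprD addrACA.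
elim/tensor_ind: y => [|y y' IHy IHy'|a2 b2].
- by rewrite (bil0r btbr) !(bil0l btac) (bil0r btac) subr0.
- by rewrite (bilDr btbr) !(bilDl btac) (bilDr btac) IHy IHy' opprD addrACA.
elim/tensor_ind: m => [|m m' IHm IHm'|a3 m].
- by rewrite !(bil0r btac) subr0.
- by rewrite !(bilDr btac) IHm IHm' opprD addrACA.
rewrite tensor_bracket_act_pure !tensor_act_pure2.
rewrite [zmul b2 b1 + _]addrC.
move: (_ \ox _) (_ \ox _) (_ \ox _) (_ \ox _) (_ \ox _) (_ \ox _) => p q s t u v.
rewrite !opprD !opprK !addrA [RHS](ACl (1*5*8*4*(2*7)*(3*6))).
by rewrite /= !addNr !addr0.
Qed.
End TensorActLie.

Section TensorLie.
Variables (K : fieldType) (g : leibnizType K) (B : zinbielType K).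

Definition tensor_bracket : tensor g B -> tensor g B -> tensor g B :=
  tensor_act (@zmul K B) (@zmul K B).

Let bz := @zmul_bilinear K B.
Let btbr : bilinear tensor_bracket := tensor_act_bilinear g bz bz.

Lemma tensor_bracketN x y : tensor_bracket x y = - tensor_bracket y x.
Proof.
elim/tensor_ind: x => [|x x' IHx IHx'|a b].
- by rewrite (bil0l btbr) (bil0r btbr) oppr0.
- by rewrite (bilDl btbr) (bilDr btbr) IHx IHx' opprD.
elim/tensor_ind: y => [|y y' IHy IHy'|a' b'].
- by rewrite (bil0l btbr) (bil0r btbr) oppr0.
- by rewrite (bilDl btbr) (bilDr btbr) IHy IHy' opprD.
by rewrite /tensor_bracket !(tensor_act_pure bz bz) opprB.
Qed.

Lemma tensor_bracket_alt x : tensor_bracket x x = 0.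
Proof.
elim/tensor_ind: x => [|x x' IHx IHx'|a b].
- by rewrite (bil0l btbr).
- by rewrite (bilDl btbr) !(bilDr btbr) IHx IHx' add0r addr0 tensor_bracketN addNr.
by rewrite /tensor_bracket (tensor_act_pure bz bz) subrr.
Qed.

Lemma tensor_jacobi x y z :
  tensor_bracket x (tensor_bracket y z) + tensor_bracket y (tensor_bracket z x) +
  tensor_bracket z (tensor_bracket x y) = 0.
Proof.
have zi := @zinbiel_identity K B.
rewrite [tensor_bracket z (_ _ _)]tensor_bracketN [tensor_bracket z x]tensor_bracketN.
rewrite (bilNr btbr) /tensor_bracket [X in _ - X](tensor_actA bz bz zi zi zi).
by rewrite addrN.
Qed.

HB.instance Definition _ := isLie.Build K (tensor g B)
  btbr tensor_bracket_alt tensor_jacobi.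

Variable M : zinbielBimodType B.

Definition tensor_action : tensor g B -> tensor g M -> tensor g M :=
  tensor_act (@lact K B M) (@ract K B M).

Lemma tensor_actionA (x y : tensor g B) (m : tensor g M) :
  tensor_action (lie_bracket x y) m =
  tensor_action x (tensor_action y m) - tensor_action y (tensor_action x m).
Proof.
exact: (tensor_actA (@lact_bilinear K B M) (@ract_bilinear K B M)
  zinbiel_mBB zinbiel_BmB zinbiel_BBm).
Qed.

HB.instance Definition _ := isLieMod.Build K (tensor g B) (tensor g M)
  (tensor_act_bilinear g (@lact_bilinear K B M) (@ract_bilinear K B M))
  tensor_actionA.

Lemma tensor_lie_bracketE (a1 a2 : g) (b1 b2 : B) :
  lie_bracket (a1 \ox b1 : tensor g B) (a2 \ox b2) =
  leibniz_bracket a1 a2 \ox zmul b1 b2 - leibniz_bracket a2 a1 \ox zmul b2 b1.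
Proof. exact: tensor_act_pure (@zmul_bilinear K B) (@zmul_bilinear K B) _ _ _ _. Qed.

Lemma tensor_lie_actE (a1 a2 : g) (b : B) (m : M) :
  lie_act (a1 \ox b : tensor g B) (a2 \ox m : tensor g M) =
  leibniz_bracket a1 a2 \ox lact b m - leibniz_bracket a2 a1 \ox ract m b.
Proof. exact: tensor_act_pure (@lact_bilinear K B M) (@ract_bilinear K B M) _ _ _ _. Qed.
End TensorLie.

Definition upd n (T : Type) (v : 'I_n -> T) (i : 'I_n) (x : T) : 'I_n -> T :=
  fun j => if j == i then x else v j.

Definition multilinear (K : fieldType) (V W : lmodType K) n
    (f : ('I_n -> V) -> W) : Prop :=
  forall v i, linear (fun x => f (upd v i x)).

Definition alternating (K : fieldType) (V W : lmodType K) n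
    (f : ('I_n -> V) -> W) : Prop :=
  forall v i j, i != j -> v i = v j -> f v = 0.

Record DL_cochain (K : fieldType) (B : zinbielType K) (M : zinbielBimodType B)
    (n : nat) := DLCochain {
  DL_fun :> ('I_n -> B) -> M;
  DL_multilinear : multilinear DL_fun }.

Record Lie_cochain (K : fieldType) (L : lieType K) (N : lieModType L)
    (n : nat) := LieCochain {
  Lie_fun :> ('I_n -> L) -> N;
  Lie_multilinear : multilinear Lie_fun;
  Lie_alternating : alternating Lie_fun }.

Section Upd.
Variables (n : nat) (T : Type).
Implicit Types (v : 'I_n -> T).

Lemma updE v i x : upd v i x i = x.
Proof. by rewrite /upd eqxx. Qed.

Lemma updC v i j x y : i != j -> upd (upd v i x) j y = upd (upd v j y) i x.
Proof.
move=> ij; apply: funext => k; rewrite /upd.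
by case: (k =P j) => // ->; rewrite eq_sym (negPf ij).
Qed.

Lemma map_upd_out v i x (r : seq 'I_n) : i \notin r -> map (upd v i x) r = map v r.
Proof.
move=> ir; apply/eq_in_map => j jr; rewrite /upd.
by case: eqP => // ji; rewrite -ji jr in ir.
Qed.

Lemma map_upd S (h : T -> S) v i x : h \o upd v i x = upd (h \o v) i (h x).
Proof. by apply: funext => j; rewrite /upd /=; case: eqP. Qed.

Lemma upd_perm v i x (s : 'S_n) : upd v i x \o s = upd (v \o s) (s^-1 i)%g x.
Proof.
apply: funext => j; rewrite /upd /=; congr (if _ then _ else _).
by rewrite -(inj_eq (@perm_inj _ s^-1%g)) permK.
Qed.
End Upd.

Section LeftNormed.
Variables (K : fieldType) (g : leibnizType K) (n : nat).
Let bb := @leibniz_bilinear K g.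
Local Notation br := (@leibniz_bracket K g).

Lemma foldl_bracket_linear s : linear (fun x : g => foldl br x s).
Proof.
elim: s => [|y s IHs] a u v //=.
by rewrite (bilDl bb) (bilZl bb) IHs.
Qed.

Lemma foldl_bracket_slot (x0 : g) (x : 'I_n -> g) i r : uniq r -> i \in r ->
  linear (fun y => foldl br x0 (map (upd x i y) r)).
Proof.
elim: r x0 => // j r IHr x0 /= /andP[jr ur].
rewrite inE => /predU1P[->|ir] a u v; last first.
  have ji : j != i by apply: contraNneq jr => ->.
  by rewrite [upd x i _ j]/upd /= (negPf ji) [upd x i _ j]/upd (negPf ji)
    [upd x i _ j]/upd (negPf ji) IHr.
rewrite !map_upd_out // !updE (bilDr bb) (bilZr bb).
exact: foldl_bracket_linear.
Qed.

Lemma left_normed_multilinear :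
  multilinear (fun x : 'I_n -> g => left_normed (map x (enum 'I_n))).
Proof.
move=> x i; have := mem_enum 'I_n i; have := enum_uniq 'I_n.
case: (enum 'I_n) => //= j r /andP[jr ur].
rewrite inE => /predU1P[->|ir] a u v.
  by rewrite !map_upd_out // !updE; apply: foldl_bracket_linear.
have ji : j != i by apply: contraNneq jr => ->.
rewrite /upd (negPf ji).
exact: foldl_bracket_slot.
Qed.
End LeftNormed.

(* The multilinear map on (V (x) W)^n extending phi on pure tensors: each
   argument t i is expanded in turn, its pure components being recorded in the
   i-th entry of p. *)
Section MultiLift.
Variables (K : fieldType) (V W U : lmodType K) (n : nat).
Variable phi : ('I_n -> V * W) -> U.

Fixpoint mlift_rec (r : seq 'I_n) (t : 'I_n -> tensor V W)
    (p : 'I_n -> V * W) : U :=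
  if r is i :: r' then
    tlift (fun v w => mlift_rec r' t (upd p i (v, w))) (t i)
  else phi p.

Definition mlift (t : 'I_n -> tensor V W) : U :=
  mlift_rec (enum 'I_n) t (fun _ => (0, 0)).

Hypothesis phi_bil : forall p i, bilinear (fun v w => phi (upd p i (v, w))).

Lemma mlift_rec_bil r t p i : uniq r -> i \notin r ->
  bilinear (fun v w => mlift_rec r t (upd p i (v, w))).
Proof.
elim: r p i => [|j r IHr] p i /=; first by move=> _ _; apply: phi_bil.
move=> /andP[jr ur]; rewrite inE negb_or => /andP[ij ir].
have IHj q := IHr (upd p i q) j ur jr.
have IHi q := IHr (upd p j q) i ur ir.
apply: bilinear_def => u a x y; elim/tensor_ind: (t j) => [|s s' IHs IHs'|v w].
- by rewrite !tlift0 ?scaler0 ?addr0 //; exact: IHr.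
- by rewrite !tliftD ?scalerDr ?IHs ?IHs' 1?addrACA //; exact: IHr.
- by rewrite !tliftE ?(updC _ _ _ ij) //; [exact: (IHi (v, w)).1|exact: IHr..].
- by rewrite !tlift0 ?scaler0 ?addr0 //; exact: IHr.
- by rewrite !tliftD ?scalerDr ?IHs ?IHs' 1?addrACA //; exact: IHr.
- by rewrite !tliftE ?(updC _ _ _ ij) //; [exact: (IHi (v, w)).2|exact: IHr..].
Qed.

Lemma mlift_rec_out r t p i x : i \notin r ->
  mlift_rec r (upd t i x) p = mlift_rec r t p.
Proof.
elim: r p => //= j r IHr p; rewrite inE negb_or => /andP[ij ir].
rewrite /upd eq_sym (negPf ij); congr tlift.
by apply: funext => v; apply: funext => w; rewrite IHr.
Qed.

Lemma mlift_rec_linear r t p i : uniq r -> i \in r ->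
  linear (fun x => mlift_rec r (upd t i x) p).
Proof.
elim: r p => //= j r IHr p /andP[jr ur].
have bil t' p' := mlift_rec_bil t' p' ur jr.
rewrite inE => /predU1P[->|ir] a x y.
  rewrite !updE; have E z : (fun v w => mlift_rec r (upd t j z) (upd p j (v, w)))
     = (fun v w => mlift_rec r t (upd p j (v, w))).
    by apply: funext => v; apply: funext => w; rewrite mlift_rec_out.
  by rewrite !E; apply: tlift_linear.
have ji : j != i by apply: contraNneq jr => ->.
have E z : upd t i z j = t j by rewrite /upd (negPf ji).
rewrite !E; elim/tensor_ind: (t j) => [|s s' IHs IHs'|v w].
- by rewrite !tlift0 ?scaler0 ?addr0.
- by rewrite !tliftD // IHs IHs' scalerDr addrACA.
- by rewrite !tliftE // IHr.
Qed.

Lemma mlift_multilinear : multilinear mlift.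
Proof. by move=> t i; apply: mlift_rec_linear; rewrite ?enum_uniq ?mem_enum. Qed.

Lemma mlift_rec_pure r p q : uniq r ->
  mlift_rec r (fun i => (q i).1 \ox (q i).2) p =
  phi (fun i => if i \in r then q i else p i).
Proof.
elim: r p => //= i r IHr p /andP[ir ur].
rewrite tliftE; last exact: mlift_rec_bil.
rewrite IHr //; congr phi; apply: funext => j; rewrite inE /upd.
by case: eqP => [->|//]; rewrite (negPf ir) -surjective_pairing.
Qed.

Lemma mliftE q : mlift (fun i => (q i).1 \ox (q i).2) = phi q.
Proof.
rewrite /mlift mlift_rec_pure ?enum_uniq //.
by congr phi; apply: funext => i; rewrite mem_enum.
Qed.
End MultiLift.

Section Psi.
Variables (K : fieldType) (g : leibnizType K) (B : zinbielType K).
Variables (M : zinbielBimodType B) (n : nat).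
Variable f : DL_cochain M n.

Definition Psi_pure (p : 'I_n -> g * B) : tensor g M :=
  left_normed [seq (p i).1 | i <- enum 'I_n] \ox f (fun i => (p i).2).

Definition Psi_fun (t : 'I_n -> tensor g B) : tensor g M :=
  \sum_(s : 'S_n) (-1) ^+ s *: mlift Psi_pure (t \o s).

Lemma Psi_pure_bil p i : bilinear (fun v w => Psi_pure (upd p i (v, w))).
Proof.
have E (v : g) (w : B) : Psi_pure (upd p i (v, w)) =
  left_normed (map (upd (fst \o p) i v) (enum 'I_n)) \ox f (upd (snd \o p) i w).
  by rewrite -(map_upd fst p i (v, w)) -(map_upd snd p i (v, w)).
have bp := @bilinear_pure K g M.
apply: bilinear_def => u a x y; rewrite !E.
  by rewrite (@left_normed_multilinear K g n _ _ a) (bilDl bp) (bilZl bp).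
by rewrite (@DL_multilinear _ _ _ _ f _ _ a) (bilDr bp) (bilZr bp).
Qed.

Lemma Psi_multilinear : multilinear Psi_fun.
Proof.
move=> t i a x y; rewrite /Psi_fun scaler_sumr -big_split /=.
apply: eq_bigr => s _; rewrite !upd_perm (mlift_multilinear Psi_pure_bil).
by rewrite scalerDr !scalerA [a * _]mulrC.
Qed.

Lemma Psi_alternating : alternating Psi_fun.
Proof.
move=> t i j ij tij; pose u := tperm i j.
have oddMu (s : 'S_n) : (s * u)%g = ~~ s :> bool.
  by rewrite odd_permM odd_tperm ij addbT.
rewrite /Psi_fun (bigID (@odd_perm _)) /=.
apply: canLR (subrK _) _; rewrite add0r -sumrN.
rewrite (reindex_inj (mulIg u)); apply: eq_big => [s|s].
  by rewrite oddMu.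
rewrite oddMu => /negPf->; rewrite scaleN1r scale1r; congr (- mlift _ _).
apply: funext => k; rewrite /= permM /u.
by case: tpermP => // ->; rewrite tij.
Qed.

Definition Psi : Lie_cochain (tensor g M) n :=
  LieCochain Psi_multilinear Psi_alternating.

Lemma PsiE (x : 'I_n -> g) (b : 'I_n -> B) :
  Psi (fun i => x i \ox b i) =
  \sum_(s : 'S_n) (-1) ^+ s *:
    (left_normed [seq x (s i) | i <- enum 'I_n] \ox f (fun i => b (s i))).
Proof.
apply: eq_bigr => s _; congr (_ *: _).
exact: (mliftE Psi_pure_bil (fun i => (x (s i), b (s i)))).
Qed.
End Psi.

Arguments Psi {K} g {B M n} f.

(* Main.v *)
Require Import Defs.
From HB Require Import structures.
From mathcomp Require Import all_boot all_order all_algebra.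
From mathcomp Require Import all_fingroup boolp.

Set Implicit Arguments.
Unset Strict Implicit.
Unset Printing Implicit Defensive.

Import GRing.Theory.
Local Open Scope ring_scope.

(** Suppose g contains elements x_1, ..., x_n whose n! left-normed brackets
    [x_s(1), ..., x_s(n)] are linearly independent; more precisely, that some
    linear form lam on g is 1 on the bracket for s = 1 and 0 on all the others.
    Then lam applied to the first tensor factor sends
    Psi f (x_1 (x) b_1, ..., x_n (x) b_n) to f (b_1, ..., b_n), so f can be
    recovered from Psi f (Psi_inj_dual).

    Such elements exist in a free Leibniz algebra on at least two generators
    because it maps onto every Leibniz algebra generated by two elements: the
    x_i can be lifted, and lam pulled back, along the morphism.  The target is
    gl_n acting on row vectors, with [(A, v), (B, w)] = (AB - BA, vB): the row
    part of a left-normed bracket of (A_i, v_i) is v_1 A_2 ... A_n.  Number the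
    basis row vectors r_0, ..., r_(n-1) and take e_0 = (0, r_0) and
    e_i = (E_(i-1,i), 0) for i > 0.  The row part of a bracket of the e_i is
    nonzero only if e_0 comes first, providing r_0, and each further factor
    moves the current basis vector to the next one.  So e_0, e_1, ..., e_(n-1)
    is the only ordering with a nonzero row part, r_(n-1)
    (left_normed_shift).

    It remains to find all e_i in a subalgebra with two generators.  Take a
    diagonal matrix D and the sum of all e_i: if D is chosen so that
    [e_i, D] = i e_i, the e_i are eigenvectors of right bracketing by D for
    distinct eigenvalues (characteristic 0), and Lagrange interpolation in this
    operator isolates each one (shift_generated). *)

Section Reduction.
Variables (K : fieldType) (g : leibnizType K) (n : nat).

(** The form lam kills all but one term of the alternating sum, so that
    lam (x) id is a left inverse of Psi on the tuples x_i (x) b_i. *)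
Lemma Psi_inj_dual (x : 'I_n -> g) (lam : g -> K) :
  scalar lam ->
  (forall s : 'S_n,
     lam (left_normed [seq x (s i) | i <- enum 'I_n]) = (s == 1%g)%:R) ->
  forall (B : zinbielType K) (M : zinbielBimodType B),
    injective (fun f : DL_cochain M n => Psi g f).
Proof.
move=> lin_lam dual B M f f' /= eqPsi.
have bil : Defs.bilinear (fun v (m : M) => lam v *: m).
  apply: bilinear_def => u a v w.
    by rewrite lin_lam scalerDl scalerA.
  by rewrite scalerDr !scalerA mulrC.
have [L LE] : exists L : {linear tensor g M -> M},
    forall v m, L (v \ox m) = lam v *: m.
  exists (HB.pack_for {linear tensor g M -> M} (tlift (fun v (m : M) => lam v *: m))
    (GRing.isLinear.Build K _ _ _ _ (tlift_linear bil))) => v m.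
  exact: tliftE.
have PsiK (h : DL_cochain M n) b :
    L (Psi g h (fun i => x i \ox b i)) = h b.
  rewrite PsiE linear_sum (bigD1 1%g) //= big1 => [|s s1].
    rewrite odd_perm1 scale1r LE dual eqxx scale1r.
    by rewrite addr0; congr (DL_fun h _); apply: funext => i; rewrite perm1.
  by rewrite linearZ /= LE dual (negPf s1) scale0r scaler0.
have eq_ff' : DL_fun f = DL_fun f'.
  by apply: funext => b; rewrite -PsiK eqPsi PsiK.
case: f f' eq_ff' {eqPsi} => [f mf] [f' mf'] /= eq_ff'.
move: mf mf'; rewrite eq_ff' => mf mf'; congr DLCochain.
exact: Prop_irrelevance.
Qed.
End Reduction.

Section Hemisemidirect.
Variables (K : fieldType) (n : nat).

(** The hemisemidirect product of gl_n with its right module of row vectors: the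
    gl_n part acts on the right only, so the bracket is not antisymmetric. *)
Definition hemi : Type := ('M[K]_n * 'rV[K]_n)%type.
HB.instance Definition _ := GRing.Lmodule.on hemi.

Definition hemi_bracket (p q : hemi) : hemi :=
  (p.1 *m q.1 - q.1 *m p.1, p.2 *m q.1).

Lemma hemi_bilinear : Defs.bilinear hemi_bracket.
Proof.
apply: bilinear_def => u a p q; congr pair => /=;
  rewrite ?mulmxDl ?mulmxDr -?scalemxAl -?scalemxAr //.
- by rewrite scalerBr opprD addrACA.
- by rewrite scalerBr opprD addrACA.
Qed.

Lemma hemi_leibniz p q r :
  hemi_bracket p (hemi_bracket q r) =
  hemi_bracket (hemi_bracket p q) r - hemi_bracket (hemi_bracket p r) q.
Proof.
congr pair; rewrite /= !(mulmxBl, mulmxBr) !mulmxA //.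
rewrite !opprB !addrA [RHS](ACl (1*8*3*6*(2*5)*(4*7))) /=.
by rewrite !addNr !addr0.
Qed.

HB.instance Definition _ := isLeibniz.Build K hemi hemi_bilinear hemi_leibniz.
End Hemisemidirect.

Section Shift.
Variables (K : fieldType) (m : nat).
Local Notation n := m.+1.
Local Notation h := (hemi K n).
Local Notation br := (@leibniz_bracket K h).

(** The i-th step of the chain r_0 -> r_1 -> ... -> r_m of basis row vectors,
    where step 0 provides r_0.  The zero matrix part of shift 0 makes the product
    vanish when this step is not the first one. *)
Definition shift (i : 'I_n) : h :=
  (delta_mx (inord i.-1) i *+ (i != ord0), delta_mx 0 i *+ (i == ord0)).

(** The binomials 'C(i + 1, 2) start at 0 and have increments i, which are
    respectively the eigenvalue of shift 0 and those of the other shifts. *)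
Definition grading : h := (diag_mx (\row_(i < n) ('C(i.+1, 2))%:R), 0).

Lemma shift_grading i : br (shift i) grading = i%:R *: shift i.
Proof.
rewrite /leibniz_bracket /= /hemi_bracket /shift; congr pair => /=.
  have [->|i0] := eqVneq i ord0; first by rewrite !mulr0n mul0mx mulmx0 subrr scaler0.
  rewrite mulr1n; apply/matrixP => j k; rewrite mul_mx_diag mul_diag_mx !mxE.
  have [->|_] := eqVneq j; last by rewrite mul0r !mulr0 subrr.
  have [->|_] := eqVneq k; last by rewrite mul0r !mulr0 subrr.
  rewrite mul1r !mulr1 inordK; last exact: leq_ltn_trans (leq_pred i) _.
  by case: i i0 => [[|i] //= lti] _; rewrite binS bin1 natrD addrAC subrr add0r.
have [->|i0] := eqVneq i ord0; last by rewrite mulr0n mul0mx scaler0.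
rewrite scale0r mulr1n; apply/rowP => j; rewrite mul_mx_diag !mxE.
by have [->|_] := eqVneq j; rewrite ?mul0r // mulr0.
Qed.

(** A basis row vector, at position k, survives a chain of steps exactly when
    these are k + 1, k + 2, ... in this order.  The boolean c is there for the
    induction: it records whether the steps made so far were the right ones. *)
Lemma foldl_shift_row (p : h) (k : nat) (c : bool) (s : seq 'I_n) :
  (k + size s < n)%N -> p.2 = delta_mx 0 (inord k) *+ c ->
  (foldl br p (map shift s)).2 =
    delta_mx 0 (inord (k + size s)) *+ (c && (map val s == iota k.+1 (size s))).
Proof.
elim: s p k c => [|i s IHs] p k c /=; first by rewrite addn0 andbT.
rewrite addnS -addSn => lt_k p2; rewrite eqseq_cons andbA.
have lt_k1 : (k.+1 < n)%N by apply: leq_ltn_trans lt_k; exact: leq_addr.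
apply: IHs => //=; rewrite {}p2.
case: c; rewrite ?mulr0n ?mul0mx //= mulr1n.
have [ik|ik] := eqVneq (i : nat) k.+1.
  have i0 : i != ord0 by apply: contra_eq_neq ik => ->.
  by rewrite i0 mulr1n mul_delta_mx_cond ik eqxx -ik inord_val.
have [->|i0] := eqVneq i ord0; first by rewrite mulr0n mulmx0.
rewrite mulr1n mul_delta_mx_cond; case: eqP => // /(congr1 val) /=.
rewrite !inordK ?(leq_ltn_trans (leq_pred _)) //; last exact: ltnW.
by move=> ki; case/eqP: ik; rewrite ki prednK // lt0n.
Qed.

Lemma left_normed_shift_row (s : seq 'I_n) : size s = n ->
  (left_normed (map shift s)).2 =
    delta_mx 0 ord_max *+ (map val s == iota 0 n).
Proof.
case: s => // i s [sz_s] /=; rewrite (@foldl_shift_row _ 0 (i == ord0)) ?sz_s //.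
  rewrite add0n eqseq_cons; congr (delta_mx 0 _ *+ _).
  by apply: val_inj; rewrite /= inordK.
by rewrite /=; have [->|//] := eqVneq i ord0; congr (delta_mx 0 _ *+ _);
  apply: val_inj; rewrite /= inordK.
Qed.

(** The last coordinate of the row part is the linear form dual to the
    identity ordering of the shifts. *)
Lemma left_normed_shift (s : 'S_n) :
  (left_normed [seq shift (s i) | i <- enum 'I_n]).2 0 ord_max = (s == 1%g)%:R.
Proof.
rewrite -[map _ _]/(map (shift \o s) _) map_comp left_normed_shift_row; last first.
  by rewrite size_map size_enum_ord.
rewrite mulmxnE mxE !eqxx; congr _%:R; congr nat_of_bool.
apply/eqP/eqP => [|->]; last first.
  by rewrite -val_enum_ord -map_comp; apply: eq_map => i; rewrite /= perm1.
rewrite -val_enum_ord => /(inj_map val_inj) es; apply/permP => i; rewrite perm1.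
have := congr1 (fun t => nth i t i) es.
by rewrite (nth_map i) ?size_enum_ord // nth_ord_enum.
Qed.
End Shift.

Lemma char0_natr_inj (K : fieldType) : [pchar K] =i pred0 ->
  injective (fun k : nat => k%:R : K).
Proof.
move=> charK i j /= ij; have nat0 := (pcharf0P K).1 charK.
wlog le_ij : i j ij / (i <= j)%N.
  by have /orP[?|?] := leq_total i j; [|symmetry]; auto.
by apply/eqP; rewrite eqn_leq le_ij -subn_eq0 -nat0 natrB // ij subrr eqxx.
Qed.

(** P stands for membership in a Leibniz subalgebra; it will be the image of the
    free algebra. *)
Section Generation.
Variables (K : fieldType) (m : nat) (P : hemi K m.+1 -> Prop).
Hypothesis charK : [pchar K] =i pred0.
Hypothesis P_lin : forall a u v, P u -> P v -> P (a *: u + v).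
Hypothesis P_br : forall u v, P u -> P v -> P (leibniz_bracket u v).
Hypotheses (P_grading : P (grading K m)) (P_sum : P (\sum_i shift K i)).

Let bb := @leibniz_bilinear K (hemi K m.+1).

(** Lagrange interpolation: applying the operators [_, grading] - j for all
    j != i to the sum of the shifts leaves a nonzero multiple of shift i. *)
Lemma shift_generated i : P (shift K i).
Proof.
have P_prod (r : seq 'I_m.+1) :
    P (\sum_(k < m.+1) (\prod_(j <- r) (k%:R - j%:R : K)) *: shift K k).
  elim: r => [|j r IHr].
    by under eq_bigr do rewrite big_nil scale1r.
  set S := (\sum_k _) in IHr.
  have brS : leibniz_bracket S (grading K m) = \sum_(k < m.+1)
      (\prod_(j <- r) (k%:R - j%:R)) *: (k%:R *: shift K k).
    rewrite (big_morph (fun u => leibniz_bracket u _)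
      (fun u v => bilDl bb u v _) (bil0l bb _)).
    by apply: eq_bigr => k _; rewrite (bilZl bb) shift_grading.
  have -> : \sum_(k < m.+1) (\prod_(j <- j :: r) (k%:R - j%:R)) *: shift K k
      = (- j%:R) *: S + leibniz_bracket S (grading K m).
    rewrite brS scaler_sumr -big_split; apply: eq_bigr => k _ /=.
    by rewrite big_cons !scalerA -scalerDl [_ * k%:R]mulrC -mulrDl addrC.
  by apply: P_lin => //; apply: P_br.
have := P_prod [seq j <- enum 'I_m.+1 | j != i].
rewrite [X in P X](bigD1 i) //= [X in _ + X]big1 => [|k ki]; last first.
  rewrite [\prod_(j <- _) _](_ : _ = 0) ?scale0r //; apply/eqP.
  rewrite prodf_seq_eq0; apply/hasP; exists k; last by rewrite /= subrr.
  by rewrite mem_filter ki mem_enum.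
rewrite addr0; set c := \prod_(j <- _) _ => Pc.
have c0 : c != 0.
  rewrite prodf_seq_neq0; apply/allP => j; rewrite mem_filter => /andP[ji _] /=.
  rewrite subr_eq0; apply: contra ji => /eqP/(char0_natr_inj charK) ij.
  exact/eqP/val_inj.
(* P is closed under a *: u + v only, hence c^-1 *: w = (c^-1 - 1) *: w + w. *)
have := P_lin (c^-1 - 1) Pc Pc.
by rewrite scalerBl scale1r subrK scalerA mulVf // scale1r.
Qed.
End Generation.

Theorem corollary4p5 (K : fieldType) (charK : [pchar K] =i pred0)
    (g : leibnizType K) (X : Type) (iota : X -> g)
    (free_g : free_leibniz iota) (rank_gt1 : exists x y : X, x <> y)
    (B : zinbielType K) (M : zinbielBimodType B) (n : nat) (n_gt0 : (0 < n)%N) :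
  injective (fun f : DL_cochain M n => Psi g f).
Proof.
case: n n_gt0 => // m _; have [x [y xy]] := rank_gt1.
pose phi z := if `[< z = x >] then grading K m else \sum_i shift K i.
have [u [[[lin_u u_br] u_iota] _]] := free_g (hemi K m.+1) phi.
have im_shift i : exists v, u v = shift K i.
  apply: (shift_generated charK (P := fun w => exists v, u v = w)).
  - by move=> a _ _ [v <-] [w <-]; exists (a *: v + w); rewrite lin_u.
  - by move=> _ _ [v <-] [w <-]; exists (leibniz_bracket v w); rewrite u_br.
  - by exists (iota x); rewrite u_iota /phi asboolT.
  - by exists (iota y); rewrite u_iota /phi asboolF //; apply: nesym.
have [v u_v] := choice im_shift.
have u_left_normed s : u (left_normed s) = left_normed (map u s).
  case: s => [|w s] /=.
    by rewrite -[0 in LHS](addNr 0) -scaleN1r lin_u scaleN1r addNr.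
  by elim: s w => //= w' s IHs w; rewrite IHs u_br.
apply: (@Psi_inj_dual _ _ _ v (fun w => (u w).2 0 ord_max)) => [a w w'|s].
  by rewrite lin_u /= !mxE.
by rewrite u_left_normed -map_comp (eq_map (fun i => u_v (s i))) left_normed_shift.
Qed.
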